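(* Let $0\le \ell<k$ be integers, with $n$ divisible by $k-\ell$, and let $p=p(n)\in[0,1]$ be such that $$\Pr\left[H\sim\mathcal H^k(n,p)\text{ contains a Hamilton }\ell\text{-cycle}\right]=1-o(1).$$ Then for every $\varepsilon>0$, letting $m_\ell=\frac{n}{k-\ell}$, $c=(1+\varepsilon)m_\ell$ and $q=\frac{cp}{\varepsilon m_\ell+1}$, provided $q\le 1$, we have $$\Pr\left[H\sim\mathcal H^k_c(n,q)\text{ contains a rainbow Hamilton }\ell\text{-cycle}\right]=1-o(1).$$
   Context: $\mathcal H^k(n,p)$ is the binomial random $k$-uniform hypergraph on $[n]$ (each $k$-subset is an edge independently with probability $p$); $\mathcal H^k_c(n,q)$ is $\mathcal H^k(n,q)$ with each edge independently assigned a uniformly random color from $[c]$. For $0\le\ell<k$, a Hamilton $\ell$-cycle in a $k$-uniform hypergraph on $n$ vertices is a cyclic ordering of the vertex set together with edges each consisting of $k$ consecutive vertices such that consecutive edges intersect in exactly $\ell$ vertices; it has $m_\ell=n/(k-\ell)$ edges. A rainbow subhypergraph has all edges of distinct colors. Asymptotics are as $n\to\infty$. *)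

(* Defs.v *)
From HB Require Import structures.
From mathcomp Require Import all_boot all_order all_algebra.
From mathcomp Require Import boolp reals.
Unset Printing Implicit Defensive.
Import Order.TTheory GRing.Theory Num.Theory.
Local Open Scope ring_scope.

(* Vertex set [n] is 'I_n; a k-uniform hypergraph on [n] is a set of k-subsets. *)
Definition ksets (n k : nat) : {set {set 'I_n}} := [set e : {set 'I_n} | #|e| == k].

Definition cyc_order (n : nat) (f : nat -> 'I_n) : Prop :=
  [/\ (forall j, f (j + n)%N = f j),
      (forall j1 j2, (j1 < n)%N -> (j2 < n)%N -> f j1 = f j2 -> j1 = j2)
    & (forall x : 'I_n, exists2 j, (j < n)%N & f j = x)].

(* The i-th edge of the l-cycle along the ordering f: the k consecutive vertices
   starting at position i*(k-l) (positions taken cyclically). *)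
Definition lseg (n k l : nat) (f : nat -> 'I_n) (i : nat) : {set 'I_n} :=
  [set f (i * (k - l) + val j)%N | j : 'I_k].

Definition nedges (n k l : nat) : nat := (n %/ (k - l))%N.

Definition lcycle_shape (n k l : nat) (f : nat -> 'I_n) : Prop :=
  cyc_order n f /\
  (forall i, (i < nedges n k l)%N -> #|lseg n k l f i :&: lseg n k l f i.+1| = l).

Definition has_ham_lcycle (n k l : nat) (H : {set {set 'I_n}}) : Prop :=
  exists f : nat -> 'I_n, lcycle_shape n k l f /\
    (forall i, (i < nedges n k l)%N -> lseg n k l f i \in H).

(* Coloured hypergraph: chi e = Some col if e is an edge of colour col, None if
   e is not an edge.  It contains a rainbow Hamilton l-cycle. *)
Definition has_rainbow_ham_lcycle (n k l c : nat)
    (chi : {ffun {set 'I_n} -> option 'I_c}) : Prop :=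
  exists f : nat -> 'I_n, lcycle_shape n k l f /\
    (forall i, (i < nedges n k l)%N -> chi (lseg n k l f i) != None) /\
    (forall i j, (i < nedges n k l)%N -> (j < nedges n k l)%N ->
       chi (lseg n k l f i) = chi (lseg n k l f j) -> i = j).

Definition prob_binom (R : realType) (n k : nat) (p : R)
    (P : {set {set 'I_n}} -> Prop) : R :=
  \sum_(H : {set {set 'I_n}} | (H \subset ksets n k) && `[< P H >])
     p ^+ #|H| * (1 - p) ^+ (#|ksets n k| - #|H|).

(* Pr[H ~ H^k_c(n,q) satisfies P]: each k-set independently is absent with
   probability 1-q, or present with colour i with probability q/c. *)
Definition prob_col (R : realType) (n k c : nat) (q : R)
    (P : {ffun {set 'I_n} -> option 'I_c} -> Prop) : R :=
  \sum_(chi : {ffun {set 'I_n} -> option 'I_c} |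
          [forall e, (chi e != None) ==> (e \in ksets n k)] && `[< P chi >])
     \prod_(e in ksets n k) (if chi e is Some _ then q / c%:R else 1 - q).

Arguments prob_binom {R} n k p P.
Arguments prob_col {R} n k c q P.

(* Main.v *)
Require Import Defs.
From HB Require Import structures.
From mathcomp Require Import all_boot all_order all_algebra.
From mathcomp Require Import boolp functions reals.
From mathcomp Require Import topology normedtype sequences derive realfun exp.
From mathcomp Require Import ring lra zify.
Import Order.TTheory GRing.Theory Num.Theory.
Import numFieldNormedType.Exports.
Local Open Scope ring_scope.

(* Write m = n/(k-l).  McDiarmid's coupling: replace the uncoloured edges (present
   with probability p') by coloured ones (present with probability q) one at a time.
   If e is needed to complete a Hamilton cycle that is rainbow on the coloured edges,
   at most m - 1 colours are forbidden for e, so the probability of success does not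
   decrease as long as p' <= q (c - m + 1) / c.

   As c is only the integer part of (1+eps) m, this inequality can fail for p' = p and
   is only available for p' = p eps m / (eps m + 1).  So one also needs that lowering
   p by a factor 1 - O(1/m) keeps Hamiltonicity likely.  This holds for every increasing
   property whose minimal elements have size at most m.  Let g(u) be the probability
   of failure at density u, and call an absent element pivotal for a failing set if
   adding it gives success.  Reveal the random set outside a random D of density
   1/(2m): each pivotal element lies in D while the rest of its minimal element is
   revealed with probability at least 1/(4m), and then failure forces it to be absent
   (as in the satisfiability coding lemma of Paturi, Pudlak and Zane).  Failing sets
   with many pivotal elements are thus exponentially unlikely, which gives
   u E[#pivotal; failure] <= 4 m g ln(1/g).  By Russo's formula the derivative of
   ln ln (1/g) is at most 4 m / (u (1-u)), hence ln(1/g) changes by at most a constant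
   factor between p' and p; the condition q <= 1 keeps p away from 1. *)

Set Implicit Arguments.
Unset Strict Implicit.

(** * Sets avoiding a family of sets of bounded size *)

Definition avoids (T : finType) (F : {set {set T}}) (B : {set T}) : bool :=
  [forall M in F, ~~ (M \subset B)].

Definition pivots (T : finType) (F : {set {set T}}) (E B : {set T}) : {set T} :=
  [set e in E :\: B | ~~ avoids F (e |: B)].

Definition forced (T : finType) (F : {set {set T}}) (E C D : {set T}) : {set T} :=
  [set e in E :&: D | [exists M in F, (e \in M) && (M :\ e \subset C)]].

Definition bern (T : finType) (R : realType) (x : T -> R) (B : {set T}) : R :=
  \prod_e (if e \in B then x e else 1 - x e).

Lemma avoidsPn (T : finType) (F : {set {set T}}) (B : {set T}) :
  reflect (exists2 M, M \in F & M \subset B) (~~ avoids F B).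
Proof.
apply: (iffP forall_inPn) => -[M MF]; first by rewrite negbK; exists M.
by move=> MB; exists M => //; rewrite negbK.
Qed.

Lemma bern_ge0 (T : finType) (R : realType) (x : T -> R) (B : {set T}) :
  (forall e, 0 <= x e <= 1) -> 0 <= bern x B.
Proof.
move=> x01; apply: prodr_ge0 => e _; have /andP[x0 x1] := x01 e.
by case: ifP; rewrite ?subr_ge0.
Qed.

Lemma prodrD_sum (T : finType) (R : comRingType) (a b : T -> R) :
  \prod_e (a e + b e) = \sum_(B : {set T}) \prod_e (if e \in B then a e else b e).
Proof. by rewrite bigA_distr; apply: eq_bigl => B; rewrite inE. Qed.

Lemma sum_bern (T : finType) (R : realType) (x : T -> R) :
  \sum_B bern x B = 1.
Proof.
rewrite -prodrD_sum /=.
by apply: big1 => e _; rewrite addrC subrK.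
Qed.

Lemma sum_bern_mem_disjoint (T : finType) (R : realType) (r : R) (e : T) (N : {set T}) :
  e \notin N ->
  \sum_D bern (fun=> r) D * ((e \in D) && [disjoint N & D])%:R = r * (1 - r) ^+ #|N|.
Proof.
move=> eN.
pose a i := if i \in N then 0 else r : R.
pose b i := if i == e then 0 else 1 - r : R.
transitivity (\prod_i (a i + b i)).
  rewrite prodrD_sum /=.
  apply: eq_bigr => D _; rewrite /bern /a /b.
  have [eD|eD] /= := boolP (e \in D); last first.
    by rewrite mulr0 [RHS](bigD1 e) //= (negbTE eD) eqxx mul0r.
  have [ND|/pred0Pn[i /andP[/= iN iD]]] := boolP [disjoint N & D]; last first.
    by rewrite mulr0 [RHS](bigD1 i) //= iD iN mul0r.
  rewrite mulr1; apply: eq_bigr => i _; case: ifPn => iD.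
    by rewrite (disjointFl ND iD).
  by case: eqP => // ie; rewrite ie eD in iD.
rewrite (bigD1 e) //= /a /b (negbTE eN) eqxx addr0; congr (_ * _).
rewrite (bigID (mem N)) /= [X in _ * X]big1 ?mulr1.
  rewrite -prodr_const; apply: eq_big => i; last first.
    by move=> /andP[/negbTE-> iN]; rewrite (iN : i \in N) add0r.
  rewrite andbC; case: (boolP (i \in N)) => //= iN.
  by apply/eqP => ie; rewrite -ie iN in eN.
by move=> i /andP[/negbTE-> iN]; rewrite (negbTE (iN : i \notin N)) addrC subrK.
Qed.

Definition splice (T : finType) (D A B : {set T}) : {set T} := (A :\: D) :|: (B :&: D).

Lemma in_splice (T : finType) (D A B : {set T}) e :
  (e \in splice D A B) = if e \in D then e \in B else e \in A.
Proof. by rewrite !inE; case: (e \in D); rewrite /= ?andbT ?andbF ?orbF. Qed.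

Lemma bern_resample (T : finType) (R : realType) (x : T -> R) (D : {set T}) (h : {set T} -> R) :
  \sum_B bern x B * h B = \sum_A bern x A * \sum_B bern x B * h (splice D A B).
Proof.
have spliceK A B : splice D (splice D A B) (splice D B A) = A.
  by apply/setP => e; rewrite !in_splice; case: (e \in D).
transitivity (\sum_A \sum_B (bern x A * bern x B) * h A).
  by apply: eq_bigr => A _; rewrite -mulr_suml -mulr_sumr sum_bern mulr1.
under [RHS]eq_bigr do rewrite mulr_sumr.
rewrite !pair_big /=.
pose sw (P : {set T} * {set T}) := (splice D P.1 P.2, splice D P.2 P.1).
have swK : involutive sw by case=> A B; rewrite /sw /= !spliceK.
rewrite (reindex_inj (inv_inj swK)) /=; apply: eq_bigr => -[A B] _ /=.
rewrite mulrA; congr (_ * _); rewrite /bern -!big_split /=.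
apply: eq_bigr => e _; rewrite !in_splice.
by case: (e \in D) => //; rewrite mulrC.
Qed.

Lemma avoids_forced (T : finType) (F : {set {set T}}) (E D A B : {set T}) :
  avoids F (splice D A B) -> [disjoint forced F E (A :\: D) D & B].
Proof.
apply: contraTT => /pred0Pn[e /andP[/= eY eB]]; apply/avoidsPn.
move: eY; rewrite !inE => /andP[/andP[_ eD] /exists_inP[M MF /andP[eM MC]]].
exists M => //; apply/subsetP => i iM; rewrite in_splice.
have [->|ie] := eqVneq i e; first by rewrite eD.
have : i \in M :\ e by rewrite !inE ie.
by move/(subsetP MC); rewrite !inE => /andP[/negbTE->].
Qed.

Lemma forced_splice (T : finType) (F : {set {set T}}) (E D A B : {set T}) :
  forced F E (splice D A B :\: D) D = forced F E (A :\: D) D.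
Proof.
congr forced; apply/setP => e; rewrite in_setD [RHS]in_setD in_splice.
by case: (e \in D).
Qed.

(* Given the part of a random set outside D, avoiding F forces every element of
   [forced] to be absent; the weight [expR (u * _)] offsets the probability of this. *)
Lemma sum_avoids_forced_le1 (T : finType) (R : realType) (x : T -> R) (u : R)
    (F : {set {set T}}) (E D : {set T}) :
  (forall e, 0 <= x e <= 1) -> (forall e, e \in E -> u <= x e) ->
  \sum_(B | avoids F B) bern x B * expR (u * #|forced F E (B :\: D) D|%:R) <= 1.
Proof.
move=> x01 ux.
pose h B := (avoids F B)%:R * expR (u * #|forced F E (B :\: D) D|%:R) : R.
have -> : \sum_(B | avoids F B) bern x B * expR (u * #|forced F E (B :\: D) D|%:R)
          = \sum_B bern x B * h B.
  rewrite big_mkcond; apply: eq_bigr => B _; rewrite /h.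
  by case: (avoids F B); rewrite ?mul1r ?mul0r ?mulr0.
rewrite (@bern_resample _ _ x D h) -[leRHS](@sum_bern _ _ x); apply: ler_sum => A _.
rewrite -[leRHS]mulr1; apply: ler_wpM2l; first exact: bern_ge0.
set Y := forced F E (A :\: D) D.
have YE e : e \in Y -> e \in E by rewrite !inE => /andP[/andP[]].
have hle B : bern x B * h (splice D A B) <=
    (\prod_e (if e \in B then (if e \in Y then 0 else x e) else 1 - x e)) *
    expR (u * #|Y|%:R).
  rewrite /h forced_splice -/Y mulrA; apply: ler_wpM2r; first exact: expR_ge0.
  case: (boolP (avoids F _)) => [/(@avoids_forced _ _ E)|_]; last first.
    rewrite mulr0; apply: prodr_ge0 => e _; have /andP[x0 x1] := x01 e.
    by do 2?case: ifP; rewrite ?subr_ge0.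
  rewrite -/Y mulr1 => YB; rewrite le_eqVlt; apply/orP; left; apply/eqP.
  by apply: eq_bigr => e _; case: ifP => // eB; rewrite (disjointFl YB eB).
apply: le_trans (ler_sum _ (fun B _ => hle B)) _; rewrite -mulr_suml.
rewrite -prodrD_sum /= (bigID (mem Y)) /=.
rewrite [X in _ * X * _]big1 ?mulr1; last first.
  by move=> e /negbTE->; rewrite addrC subrK.
have -> : expR (u * #|Y|%:R) = \prod_(e in Y) expR u :> R.
  by rewrite prodr_const -expRM_natr.
rewrite -big_split /=; apply: prodr_ile1 => e eY; rewrite eY add0r.
have /andP[x0 x1] := x01 e; rewrite mulr_ge0 ?subr_ge0 ?expR_ge0 //=.
have := ux e (YE e eY) => uxe.
apply: (@le_trans _ _ (expR (- u) * expR u)); last by rewrite -expRD addNr expR0.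
apply: ler_wpM2r; first exact: expR_ge0.
by apply: le_trans (expR_ge1Dx _); lra.
Qed.

Lemma bernoulli_ineq (R : realType) (r : R) n : 0 <= r <= 1 -> 1 - n%:R * r <= (1 - r) ^+ n.
Proof.
move=> /andP[r0 r1]; elim: n => [|n IH]; first by rewrite mul0r subr0 expr0.
rewrite exprS -natr1.
have := ler_wpM2l (_ : 0 <= 1 - r) IH; rewrite subr_ge0 => /(_ r1).
apply: le_trans; have : 0 <= n%:R * r * r by rewrite !mulr_ge0.
nra.
Qed.

Lemma sum_card_forced (T : finType) (R : realType) (F : {set {set T}}) (E B : {set T}) (s : nat) :
  (0 < s)%N -> (forall M, M \in F -> (#|M| <= s)%N) -> avoids F B ->
  #|pivots F E B|%:R / (4 * s%:R) <=
  \sum_D bern (fun=> (2 * s%:R)^-1) D * #|forced F E (B :\: D) D|%:R :> R.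
Proof.
move=> s0 Fs avB; set r : R := (2 * s%:R)^-1.
have s1 : 1 <= s%:R :> R by rewrite ler1n.
have r01 : 0 <= r <= 1 by rewrite /r invr_ge0 mulr_ge0 //= invf_le1; nra.
have [r0 r1] := andP r01.
have -> : \sum_D bern (fun=> r) D * #|forced F E (B :\: D) D|%:R =
          \sum_e \sum_D bern (fun=> r) D * (e \in forced F E (B :\: D) D)%:R.
  rewrite exchange_big /=; apply: eq_bigr => D _.
  by rewrite -mulr_sumr -natr_sum -big_mkcond sum1_card.
rewrite -sum1_card natr_sum mulr_suml big_mkcond /=; apply: ler_sum => e _.
have bge0 D : 0 <= bern (fun=> r) D by apply: bern_ge0.
case: ifP => [|_]; last by apply: sumr_ge0 => D _; rewrite mulr_ge0.
rewrite !inE => /andP[/andP[eB eE] /avoidsPn[M MF MB]].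
have eM : e \in M.
  apply: contraTT avB => eM; apply/avoidsPn; exists M => //.
  apply/subsetP => i iM; have /(subsetP MB) := iM; rewrite !inE => /orP[/eqP ie|//].
  by rewrite -ie iM in eM.
apply: (@le_trans _ _ (\sum_D bern (fun=> r) D * ((e \in D) && [disjoint M :\ e & D])%:R)).
  rewrite sum_bern_mem_disjoint ?setD11 //.
  have Ms : #|M :\ e|%:R <= s%:R :> R.
    by rewrite ler_nat (leq_trans (subset_leq_card (subsetDl _ _))) ?Fs.
  have rs : s%:R * r = 1 / 2 by rewrite /r invfM mulrCA mulfV ?mulr1 ?mul1r//; lra.
  have -> : 1%:R / (4 * s%:R) = r * (1 / 2) by rewrite /r !invfM !mul1r mulrAC; congr (_ * _); lra.
  apply: ler_wpM2l => //; apply: le_trans (@bernoulli_ineq _ _ _ r01).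
  have := ler_wpM2r r0 Ms; lra.
apply: ler_sum => D _; apply: ler_wpM2l => //; rewrite ler_nat.
case: (boolP (_ && _)) => // /andP[eD MD]; rewrite lt0b !inE eE eD /=.
apply/exists_inP; exists M => //; rewrite eM /=.
apply/subsetP => i iM; rewrite !inE (disjointFr MD iM) /=.
by move: iM; rewrite !inE => /andP[ie /(subsetP MB)]; rewrite !inE (negbTE ie).
Qed.

Lemma sum_pivots_le (T : finType) (R : realType) (x : T -> R) (u : R)
    (F : {set {set T}}) (E : {set T}) (s : nat) :
  (0 < s)%N -> (forall M, M \in F -> (#|M| <= s)%N) -> 0 <= u ->
  (forall e, 0 <= x e <= 1) -> (forall e, e \in E -> u <= x e) ->
  let g := \sum_(B | avoids F B) bern x B in 0 < g ->
  u / (4 * s%:R) * \sum_(B | avoids F B) bern x B * #|pivots F E B|%:R <= g * - ln g.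
Proof.
move=> s0 Fs u0 x01 ux g g0.
pose b := @bern T R (fun=> (2 * s%:R)^-1 : R).
have s1 : 1 <= s%:R :> R by rewrite ler1n.
have b0 (D : {set T}) : 0 <= b D.
  by apply: bern_ge0 => _; rewrite invr_ge0 mulr_ge0 //= invf_le1; nra.
pose y D B : R := #|forced F E (B :\: D) D|%:R.
apply: (@le_trans _ _ (\sum_(B | avoids F B) bern x B * \sum_D b D * (u * y D B))).
  rewrite mulr_sumr; apply: ler_sum => B avB; rewrite mulrCA.
  apply: ler_wpM2l; first exact: bern_ge0.
  under eq_bigr do rewrite mulrCA.
  rewrite -mulr_sumr -mulrA; apply: ler_wpM2l => //.
  by rewrite mulrC sum_card_forced.
have tangent z : z <= g * expR z - 1 - ln g.
  have := expR_ge1Dx (z + ln g); rewrite expRD lnK // mulrC; lra.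
apply: (@le_trans _ _ (\sum_(B | avoids F B) bern x B *
          \sum_D b D * (g * expR (u * y D B) - 1 - ln g))).
  apply: ler_sum => B _; apply: ler_wpM2l; first exact: bern_ge0.
  by apply: ler_sum => D _; apply: ler_wpM2l.
under eq_bigr do rewrite mulr_sumr.
rewrite exchange_big /=.
under eq_bigr => D _.
  under eq_bigr do rewrite mulrCA.
  rewrite -mulr_sumr.
  over.
apply: (@le_trans _ _ (\sum_D b D * (g * - ln g))); last first.
  by rewrite -mulr_suml sum_bern mul1r.
apply: ler_sum => D _; apply: ler_wpM2l => //.
under eq_bigr do rewrite -addrA mulrDr mulrCA.
rewrite big_split /= -mulr_sumr -mulr_suml -/g.
have := ler_wpM2l (ltW g0) (@sum_avoids_forced_le1 _ _ x u F E D x01 ux).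
rewrite -/g /y; lra.
Qed.

(** * Derivative of the avoidance probability *)

Definition avoid_poly (T : finType) (R : realType) (F : {set {set T}}) (E : {set T}) : {poly R} :=
  \sum_(B : {set T} | (B \subset E) && avoids F B) 'X^#|B| * (1 - 'X) ^+ (#|E| - #|B|).

Lemma bern_on (T : finType) (R : realType) (E B : {set T}) (u : R) :
  bern (fun e => if e \in E then u else 0) B =
  if B \subset E then u ^+ #|B| * (1 - u) ^+ (#|E| - #|B|) else 0.
Proof.
rewrite /bern; case: ifPn => [BE|/subsetPn[e eB eE]]; last first.
  by rewrite (bigD1 e) //= eB (negbTE eE) mul0r.
rewrite (bigID (mem B)) /=; congr (_ * _).
  rewrite -prodr_const; apply: eq_bigr => e eB.
  by rewrite (eB : e \in B) (subsetP BE _ eB).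
have -> : (#|E| - #|B|)%N = #|E :\: B| by rewrite cardsD (setIidPr BE).
rewrite -prodr_const [LHS]big_mkcond [RHS]big_mkcond /=; apply: eq_bigr => e _.
by rewrite inE; do 2?[case: (e \in _)] => //=; rewrite subr0.
Qed.

Lemma horner_avoid_poly (T : finType) (R : realType) (F : {set {set T}}) (E : {set T}) (u : R) :
  (avoid_poly R F E).[u] = \sum_(B | avoids F B) bern (fun e => if e \in E then u else 0) B.
Proof.
rewrite /avoid_poly horner_sum [RHS](bigID (fun B : {set T} => B \subset E)) /=.
rewrite [X in _ = _ + X]big1 ?addr0; last first.
  by move=> B /andP[_ /negbTE BE]; rewrite bern_on BE.
apply: eq_big => [B|B /andP[BE _]]; first by rewrite andbC.
by rewrite bern_on BE !hornerE.
Qed.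

Lemma avoidsS (T : finType) (F : {set {set T}}) (A B : {set T}) :
  A \subset B -> avoids F B -> avoids F A.
Proof.
move=> AB; apply: contraTT => /avoidsPn[M MF MA]; apply/avoidsPn; exists M => //.
exact: subset_trans AB.
Qed.

Lemma avoid_poly_derivative (T : finType) (R : realType) (F : {set {set T}}) (E : {set T}) (u : R) :
  (1 - u) * (avoid_poly R F E)^`().[u] =
  - \sum_(B | avoids F B) bern (fun e => if e \in E then u else 0) B * #|pivots F E B|%:R.
Proof.
pose w (B : {set T}) := u ^+ #|B| * (1 - u) ^+ (#|E| - #|B|).
pose P (B : {set T}) := (B \subset E) && avoids F B.
have -> : \sum_(B | avoids F B) bern (fun e => if e \in E then u else 0) B * #|pivots F E B|%:R
        = \sum_(B | P B) w B * #|pivots F E B|%:R.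
  rewrite (bigID (fun B : {set T} => B \subset E)) /= [X in _ + X]big1 ?addr0.
    by apply: eq_big => [B|B /andP[_ BE]]; rewrite 1?andbC // bern_on BE.
  by move=> B /andP[_ /negbTE BE]; rewrite bern_on BE mul0r.
have dterm (B : {set T}) : P B ->
    (1 - u) * ('X^#|B| * (1 - 'X) ^+ (#|E| - #|B|))^`().[u] =
    \sum_(e in E) (if e \in B then w (B :\ e) else - w B).
  move=> /andP[BE _]; rewrite (bigID (mem B)) /=.
  have -> : \sum_(e in E | e \in B) (if e \in B then w (B :\ e) else - w B) =
            #|B|%:R * (u ^+ #|B|.-1 * (1 - u) ^+ (#|E| - #|B|).+1).
    rewrite mulr_natl -sumr_const; apply: eq_big => [e|e /andP[eE eB]].
      by rewrite andbC; case: (boolP (e \in B)) => //= /(subsetP BE).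
    have cB := cardsD1 e B; rewrite eB add1n in cB.
    have := subset_leq_card BE; rewrite eB /w cB /= => cE.
    by rewrite subnSK.
  have -> : \sum_(e in E | e \notin B) (if e \in B then w (B :\ e) else - w B) =
            - ((#|E| - #|B|)%:R * w B).
    have -> : (#|E| - #|B|)%N = #|E :\: B| by rewrite cardsD (setIidPr BE).
    rewrite mulr_natl -mulNrn -sumr_const; apply: eq_big => [e|e /andP[eE /negbTE-> //]].
    by rewrite inE andbC.
  have -> : (1 - 'X : {poly R}) = 1%:P - 'X by [].
  rewrite derivM derivXn deriv_exp.
  rewrite derivB derivC derivX sub0r /w exprS.
  case: (#|E| - #|B|)%N => [|b] /=.
    by rewrite !mulr0n mulr0 addr0 !hornerE hornerMn !hornerE /= -mulr_natl; ring.
  rewrite !(hornerE, hornerMn) /= -[_ *+ #|B|]mulr_natl -[_ *+ b.+1]mulr_natl (exprS _ b).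
  ring.
rewrite /avoid_poly (big_morph _ (@derivD R) (@deriv0 R)) horner_sum mulr_sumr.
rewrite (eq_bigr _ dterm) exchange_big /=.
have -> : \sum_(B | P B) w B * #|pivots F E B|%:R =
          \sum_(e in E) \sum_(B | P B) w B * (e \in pivots F E B)%:R.
  rewrite exchange_big /=; apply: eq_bigr => B _.
  rewrite -mulr_sumr -natr_sum -sum1_card big_mkcond [in RHS]big_mkcond /=.
  congr (_ * _%:R); apply: eq_bigr => e _; rewrite !inE.
  by case: (e \in E); rewrite ?andbF.
rewrite -sumrN; apply: eq_bigr => e eE.
have -> : \sum_(B | P B) w B * (e \in pivots F E B)%:R =
          \sum_(B | P B && (e \notin B)) w B * (~~ avoids F (e |: B))%:R.
  rewrite [LHS](bigID (fun B : {set T} => e \in B)) /= big1 ?add0r.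
    by apply: eq_bigr => B /andP[_ eB]; rewrite !inE eB eE.
  by move=> B /andP[_ eB]; rewrite !inE eB mulr0.
rewrite (bigID (fun B : {set T} => e \in B)) /=.
have -> : \sum_(B | P B && (e \in B)) (if e \in B then w (B :\ e) else - w B) =
          \sum_(B | P B && (e \notin B)) w B * (avoids F (e |: B))%:R.
  rewrite (reindex_onto (fun B => e |: B) (fun B => B :\ e)) /=; last first.
    by move=> B /andP[_ eB]; rewrite setD1K.
  rewrite big_mkcond [RHS]big_mkcond; apply: eq_bigr => B _.
  rewrite setU11 andbT; have [eB|eB] := boolP (e \in B).
    rewrite !andbF; case: ifP => // /andP[_ /eqP eB'].
    by move: eB; rewrite -eB' setD11.
  rewrite setU1K // eqxx !andbT /P subUset sub1set eE /=.
  case: (boolP (B \subset E)) => //= BE; case: (boolP (avoids F (e |: B))) => [av|_].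
    by rewrite (avoidsS (subsetUr _ _) av) mulr1.
  by rewrite mulr0 if_same.
rewrite -big_split -sumrN; apply: eq_bigr => B /andP[_ eB] /=.
by rewrite (negbTE eB); case: (avoids F _); rewrite /= ?mulr1 ?mulr0; ring.
Qed.

Lemma neg_ln_transfer (R : realType) (G : {poly R}) (a b D : R) :
  a < b ->
  (forall u, a <= u <= b -> 0 < G.[u] < 1) ->
  (forall u, a <= u <= b -> - G^`().[u] * (b - a) <= D * (G.[u] * - ln G.[u])) ->
  - ln G.[b] <= expR D * - ln G.[a].
Proof.
move=> ab G01 dG.
have lnG u : a <= u <= b -> 0 < - ln G.[u].
  by move=> /G01 G01u; rewrite oppr_gt0 ln_lt0.
pose f u := ln (- ln G.[u]); pose df u := (- ln G.[u])^-1 * - (G.[u]^-1 * G^`().[u]).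
have dfE u : a <= u <= b -> is_derive u 1 f (df u).
  move=> uab; have /andP[G0 G1] := G01 u uab.
  have ? : is_derive (horner G u) 1 (@ln R) G.[u]^-1 := is_derive1_ln G0.
  have d1 : is_derive u 1 (@ln R \o horner G) (G.[u]^-1 * G^`().[u]).
    exact: is_derive1_comp.
  have d2 : is_derive u 1 (- (@ln R \o horner G)) (- (G.[u]^-1 * G^`().[u])).
    exact: is_deriveN.
  have ? : is_derive ((- (@ln R \o horner G)) u) 1 (@ln R) (- ln G.[u])^-1.
    by apply: is_derive1_ln; exact: lnG.
  have -> : f = @ln R \o (- (@ln R \o horner G)) by [].
  exact: is_derive1_comp.
have [||c cab fab] := @MVT _ f df a b ab.
- by move=> u /[!in_itv]/= /andP[/ltW au /ltW ub]; apply: dfE; rewrite au.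
- apply: derivable_within_continuous => u /[!in_itv]/= uab.
  by have [] := dfE u uab.
have {}cab : a <= c <= b by move: cab; rewrite in_itv /= => /andP[/ltW-> /ltW->].
have /andP[G0 _] := G01 c cab; have L0 := lnG c cab.
have fD : f b - f a <= D.
  rewrite fab /df mulrN -mulNr -invrN.
  have := dG c cab; rewrite -ler_pdivrMr ?mulr_gt0 // => h; apply: le_trans h.
  rewrite le_eqVlt; apply/orP; left; apply/eqP.
  by field; rewrite (gt_eqF G0) -oppr_eq0 (gt_eqF L0).
rewrite -[leLHS]lnK ?posrE ?lnG ?(ltW ab) ?lexx // -[X in _ * X]lnK ?posrE ?lnG ?(ltW ab) ?lexx //.
by rewrite -expRD ler_expR; rewrite /f in fD; lra.
Qed.

(** * Rainbow coupling *)

Definition ffun_upd (T A : finType) (w : {ffun T -> A}) (e0 : T) (a : A) : {ffun T -> A} :=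
  [ffun e => if e == e0 then a else w e].

Definition prod_wt (T A : finType) (R : realType) (mu : T -> A -> R) (w : {ffun T -> A}) : R :=
  \prod_e mu e (w e).

Lemma prod_wt_resample (T A : finType) (R : realType) (mu nu : T -> A -> R) (e0 : T)
    (h : {ffun T -> A} -> R) :
  (forall e, e != e0 -> mu e =1 nu e) -> \sum_a nu e0 a = 1 ->
  \sum_w prod_wt mu w * h w =
  \sum_w prod_wt nu w * \sum_a mu e0 a * h (ffun_upd w e0 a).
Proof.
move=> munu nu1.
transitivity (\sum_w \sum_a (prod_wt mu w * nu e0 a) * h w).
  by apply: eq_bigr => w _; rewrite -mulr_suml -mulr_sumr nu1 mulr1.
under [RHS]eq_bigr do rewrite mulr_sumr.
rewrite !pair_big /=.
pose sw (P : {ffun T -> A} * A) := (ffun_upd P.1 e0 P.2, P.1 e0).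
have updK w a : ffun_upd (ffun_upd w e0 a) e0 (w e0) = w.
  by apply/ffunP => e; rewrite !ffunE; case: eqP => [->|].
have swK : involutive sw by case=> w a; rewrite /sw /= updK ffunE eqxx.
rewrite [RHS](reindex_inj (inv_inj swK)) /=; apply: eq_bigr => -[w a] _ /=.
rewrite updK mulrA; congr (_ * _); rewrite /prod_wt.
rewrite (bigD1 e0) //= [in RHS](bigD1 e0) //= ffunE eqxx.
rewrite [RHS]mulrAC mulrC mulrA; congr (_ * _).
by apply: eq_bigr => e ne; rewrite ffunE (negbTE ne) munu.
Qed.

Lemma mulr_bool_le (R : realType) (x : R) (b : bool) : 0 <= x -> x * b%:R <= x.
Proof. by case: b; rewrite ?mulr1 ?mulr0. Qed.

Section Coupling.
Variables (T : finType) (R : realType) (c m : nat) (F : {set {set T}}) (E : {set T}) (p q : R).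

(* The elements of S are coloured (and present with probability q); for the other
   elements of E only presence matters, and it has probability p. *)
Definition hybrid_wt (S : {set T}) (e : T) (a : option 'I_c) : R :=
  if e \in E then
    let r := if e \in S then q else p in if a is Some _ then r / c%:R else 1 - r
  else (a == None)%:R.

Definition rainbow_on (S : {set T}) (w : {ffun T -> option 'I_c}) : bool :=
  [exists M in F, [forall e in M, w e != None] &&
    [forall e in M :&: S, forall e' in M :&: S, (w e == w e') ==> (e == e')]].

Lemma rainbow_onP (S : {set T}) (w : {ffun T -> option 'I_c}) :
  reflect (exists2 M, M \in F & (forall e, e \in M -> w e != None) /\
    (forall e e', e \in M -> e' \in M -> e \in S -> e' \in S -> w e = w e' -> e = e'))
    (rainbow_on S w).
Proof.
apply: (iffP exists_inP) => -[M MF].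
  move=> /andP[/forall_inP Mw /forall_inP inj]; exists M => //; split=> // e e' eM e'M eS e'S ee'.
  have eMS : e \in M :&: S by rewrite inE eM.
  have e'MS : e' \in M :&: S by rewrite inE e'M.
  by have /forall_inP/(_ e' e'MS) := inj e eMS; rewrite ee' eqxx => /eqP.
move=> [Mw inj]; exists M => //; apply/andP; split; first exact/forall_inP.
apply/forall_inP => e /setIP[eM eS]; apply/forall_inP => e' /setIP[e'M e'S].
by apply/implyP => /eqP ee'; rewrite (inj e e').
Qed.

Hypothesis c0 : (0 < c)%N.

Lemma sum_option (h : option 'I_c -> R) : \sum_a h a = h None + \sum_i h (Some i).
Proof.
rewrite (bigD1 None) //=; congr (_ + _).
rewrite (reindex_onto Some (fun a => odflt (Ordinal c0) a)) /=.
  by apply: eq_bigl => i; rewrite eqxx.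
by case.
Qed.

Lemma sum_hybrid_wt (S : {set T}) (e : T) : \sum_a hybrid_wt S e a = 1.
Proof.
rewrite sum_option /hybrid_wt; case: ifP => _ /=; last first.
  by rewrite big1 ?addr0.
rewrite sumr_const card_ord -(mulr_natr (_ / _)) divfK ?pnatr_eq0 -?lt0n //.
by rewrite subrK.
Qed.

Hypothesis p01 : 0 <= p <= 1.
Hypothesis q01 : 0 <= q <= 1.
Hypothesis Fm : forall M, M \in F -> (#|M| <= m)%N.
Hypothesis pq : p <= q / c%:R * (c%:R - m%:R + 1).

Lemma hybrid_wt_ge0 (S : {set T}) (e : T) a : 0 <= hybrid_wt S e a.
Proof.
have /andP[p0 p1] := p01; have /andP[q0 q1] := q01.
rewrite /hybrid_wt; case: ifP => //= _; case: a => [i|]; case: ifP => _;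
  by rewrite ?divr_ge0 ?subr_ge0.
Qed.

Lemma rainbow_on_upd (S : {set T}) (w : {ffun T -> option 'I_c}) (e0 : T) a :
  rainbow_on S (ffun_upd w e0 None) -> rainbow_on (e0 |: S) (ffun_upd w e0 a).
Proof.
move=> /rainbow_onP[M MF [Mw inj]].
have ne e : e \in M -> e != e0.
  by move=> /Mw; rewrite ffunE; case: (eqVneq e e0).
have updE b e : e \in M -> ffun_upd w e0 b e = w e.
  by move=> /ne /negbTE nee; rewrite ffunE nee.
apply/rainbow_onP; exists M => //; split=> [e eM|e e' eM e'M].
  by have := Mw e eM; rewrite !updE.
rewrite !inE (negbTE (ne _ eM)) (negbTE (ne _ e'M)) /= => eS e'S.
by have := inj e e' eM e'M eS e'S; rewrite !updE.
Qed.

Lemma rainbow_on_step (S : {set T}) (w : {ffun T -> option 'I_c}) (e0 : T) :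
  e0 \in E -> e0 \notin S ->
  \sum_a hybrid_wt S e0 a * (rainbow_on S (ffun_upd w e0 a))%:R <=
  \sum_a hybrid_wt (e0 |: S) e0 a * (rainbow_on (e0 |: S) (ffun_upd w e0 a))%:R.
Proof.
move=> eE eS; have /andP[p0 p1] := p01; have /andP[q0 q1] := q01.
have cR : 0 < c%:R :> R by rewrite ltr0n.
have [N|N] := boolP (rainbow_on S (ffun_upd w e0 None)).
  apply: (@le_trans _ _ 1).
    rewrite -[leRHS](sum_hybrid_wt S e0); apply: ler_sum => a _.
    by apply: mulr_bool_le; exact: hybrid_wt_ge0.
  rewrite -[leLHS](sum_hybrid_wt (e0 |: S) e0); apply: ler_sum => a _.
  by rewrite rainbow_on_upd ?mulr1.
have [/existsP[i J]|/existsPn J] := boolP [exists i, rainbow_on S (ffun_upd w e0 (Some i))];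
  last first.
  rewrite big1 => [|[i|] _]; last 2 first.
  - by rewrite (negbTE (J i)) mulr0.
  - by rewrite (negbTE N) mulr0.
  by apply: sumr_ge0 => a _; rewrite mulr_ge0 ?hybrid_wt_ge0.
apply: (@le_trans _ _ p).
  rewrite sum_option (negbTE N) mulr0 add0r.
  apply: (@le_trans _ _ (\sum_(j < c) p / c%:R)).
    apply: ler_sum => j _; rewrite /hybrid_wt eE (negbTE eS).
    by apply: mulr_bool_le; rewrite divr_ge0.
  by rewrite sumr_const card_ord -(mulr_natr (_ / _)) divfK ?gt_eqF.
apply: le_trans pq _.
have /rainbow_onP[M MF [Mw inj]] := J.
have eM : e0 \in M.
  apply: contraT => eM; case/negP: N; apply/rainbow_onP; exists M => //.
  have updE b e : e \in M -> ffun_upd w e0 b e = w e.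
    by move=> eM'; rewrite ffunE; case: eqP => // ee; rewrite ee (negbTE eM) in eM'.
  split=> [e eM'|e e' eM' e'M]; first by have := Mw e eM'; rewrite !updE.
  by have := inj e e' eM' e'M; rewrite !updE.
pose used := [set j | Some j \in [set w e | e in M :\ e0]].
have usedm : (#|used| < m)%N.
  apply: (@leq_trans #|M|); last exact: Fm.
  rewrite (cardsD1 e0 M) eM add1n ltnS.
  apply: leq_trans (leq_imset_card w (M :\ e0)).
  have -> : #|used| = #|[set Some j | j in used]| by rewrite card_imset //; exact: Some_inj.
  by apply: subset_leq_card; apply/subsetP => x /imsetP[j]; rewrite inE => jw ->.
apply: (@le_trans _ _ (q / c%:R * #|~: used|%:R)).
  apply: ler_wpM2l; first by rewrite divr_ge0.
  have := cardsC used; rewrite card_ord => cE.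
  have : (c.+1 <= #|~: used| + m)%N by move: usedm cE; lia.
  by rewrite -(ler_nat R) natrD -addn1 natrD; lra.
rewrite sum_option /hybrid_wt eE setU11 -[leLHS]add0r; apply: lerD.
  by rewrite mulr_ge0 ?subr_ge0.
rewrite -mulr_sumr; apply: ler_wpM2l; first by rewrite divr_ge0.
rewrite -sum1_card natr_sum [leLHS]big_mkcond; apply: ler_sum => j _ /=.
case: ifP => //; rewrite !inE => jused; rewrite ler1n lt0b.
have fresh e : e \in M -> e != e0 -> w e != Some j.
  by move=> eM' ne; apply: contraNneq jused => <-; apply: imset_f; rewrite !inE ne.
apply/rainbow_onP; exists M => //; split=> [e eM'|e e' eM' e'M].
  by have := Mw e eM'; rewrite !ffunE; case: ifP.
rewrite !inE !ffunE; have [->|ne] := eqVneq e e0; have [->|ne'] := eqVneq e' e0 => //=.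
- by move=> _ _ h; case/eqP: (fresh e' e'M ne').
- by move=> _ _ h; case/eqP: (fresh e eM' ne).
move=> eS' e'S; have := inj e e' eM' e'M eS' e'S.
by rewrite !ffunE (negbTE ne) (negbTE ne').
Qed.

Lemma rainbow_on_mono (S : {set T}) (e0 : T) :
  e0 \in E -> e0 \notin S ->
  \sum_w prod_wt (hybrid_wt S) w * (rainbow_on S w)%:R <=
  \sum_w prod_wt (hybrid_wt (e0 |: S)) w * (rainbow_on (e0 |: S) w)%:R.
Proof.
move=> eE eS.
rewrite (@prod_wt_resample _ _ _ _ (hybrid_wt S) e0) ?sum_hybrid_wt //.
rewrite [leRHS](@prod_wt_resample _ _ _ _ (hybrid_wt S) e0) ?sum_hybrid_wt //; last first.
  by move=> e ne a; rewrite /hybrid_wt !inE (negbTE ne).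
apply: ler_sum => w _; apply: ler_wpM2l; last exact: rainbow_on_step.
by apply: prodr_ge0 => e _; apply: hybrid_wt_ge0.
Qed.

Lemma rainbow_on_le :
  \sum_w prod_wt (hybrid_wt set0) w * (rainbow_on set0 w)%:R <=
  \sum_w prod_wt (hybrid_wt E) w * (rainbow_on E w)%:R.
Proof.
suff h (s : seq T) : uniq s -> {subset s <= E} ->
    \sum_w prod_wt (hybrid_wt set0) w * (rainbow_on set0 w)%:R <=
    \sum_w prod_wt (hybrid_wt [set x in s]) w * (rainbow_on [set x in s] w)%:R.
  have := h (enum E) (enum_uniq _) (fun e => _).
  have -> : [set x in enum E] = E by apply/setP => e; rewrite inE mem_enum.
  by apply => e; rewrite mem_enum.
elim: s => [|e s IH] /=.
  by have -> : [set x in [::]] = set0 :> {set T} by apply/setP => e; rewrite !inE.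
move=> /andP[es us] sE.
have -> : [set x in e :: s] = e |: [set x in s] by apply/setP => x; rewrite !inE.
apply: le_trans (IH us _) (@rainbow_on_mono [set x in s] e _ _).
- by move=> x xs; rewrite sE // inE xs orbT.
- by rewrite sE // mem_head.
- by rewrite inE.
Qed.

Lemma sum_rainbow_on0 :
  \sum_w prod_wt (hybrid_wt set0) w * (rainbow_on set0 w)%:R =
  \sum_(B | ~~ avoids F B) bern (fun e => if e \in E then p else 0) B.
Proof.
pose supp (w : {ffun T -> option 'I_c}) := [set e | w e != None].
have rbE w : rainbow_on set0 w = ~~ avoids F (supp w).
  apply/rainbow_onP/avoidsPn => -[M MF].
    by move=> [Mw _]; exists M => //; apply/subsetP => e eM; rewrite inE Mw.
  move=> /subsetP Mw; exists M => //; split=> [e /Mw|e e' _ _]; rewrite inE //.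
rewrite (partition_big supp predT) //= [RHS]big_mkcond; apply: eq_bigr => B _.
transitivity (\sum_(w | supp w == B) prod_wt (hybrid_wt set0) w * (~~ avoids F B)%:R).
  by apply: eq_bigr => w /eqP <-; rewrite rbE.
rewrite -mulr_suml; have -> : \sum_(w | supp w == B) prod_wt (hybrid_wt set0) w =
    bern (fun e => if e \in E then p else 0) B.
  pose Q e (a : option 'I_c) := (a != None) == (e \in B).
  transitivity (\sum_(w in family Q) prod_wt (hybrid_wt set0) w).
    apply: eq_bigl => w; apply/eqP/familyP => [wB e|wQ]; first by rewrite unfold_in /Q -wB inE eqxx.
    by apply/setP => e; rewrite inE; have := wQ e; rewrite unfold_in /Q => /eqP.
  rewrite -(bigA_distr_big_dep Q (hybrid_wt set0)); apply: eq_bigr => e _.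
  rewrite big_mkcond sum_option /Q /hybrid_wt /= inE.
  case: (e \in B) => /=; case: (e \in E) => /=.
  - by rewrite add0r sumr_const card_ord -(mulr_natr (_ / _)) divfK ?pnatr_eq0 -?lt0n.
  - by rewrite add0r big1.
  - by rewrite big1 ?addr0.
  - by rewrite big1 ?addr0 ?subr0.
by case: ifP => _; rewrite ?mulr1 ?mulr0.
Qed.

End Coupling.

(** * Hamilton cycles *)

Lemma cyc_order_modn (n : nat) (f : nat -> 'I_n) (x y : nat) :
  cyc_order n f -> f x = f y -> x = y %[mod n].
Proof.
move=> [per inj _] fxy.
have n0 : (0 < n)%N by apply: leq_ltn_trans (ltn_ord (f 0%N)).
have fmod z : f z = f (z %% n)%N.
  rewrite {1}(divn_eq z n) addnC; elim: (z %/ n)%N => [|d IH]; first by rewrite addn0.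
  by rewrite mulSn addnCA addnC per.
by apply: inj; rewrite ?ltn_mod // -!fmod.
Qed.

Lemma in_lseg (n k l : nat) (f : nat -> 'I_n) (i : nat) (y : 'I_n) :
  reflect (exists2 t, (t < k)%N & y = f (i * (k - l) + t)%N) (y \in lseg n k l f i).
Proof.
apply: (iffP imsetP) => [[t _ ->]|[t tk ->]]; first by exists (val t); rewrite ?ltn_ord.
by exists (Ordinal tk).
Qed.

Lemma lseg_inj (n k l : nat) (f : nat -> 'I_n) (i j : nat) :
  (l < k)%N -> (k < n)%N -> (k - l %| n)%N -> cyc_order n f ->
  (i < nedges n k l)%N -> (j < nedges n k l)%N -> lseg n k l f i = lseg n k l f j -> i = j.
Proof.
move=> lk kn dn cf; wlog : i j / (i < j)%N.
  move=> wl im jm ij; case: (ltngtP i j) => // h; first exact: wl.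
  by apply/esym/wl.
move=> ij _ jm seg; exfalso.
have jn : (j * (k - l) < n)%N.
  by rewrite -(divnK dn) ltn_pmul2r ?subn_gt0.
have abs x d : (0 < d)%N -> (d < n)%N -> f (x + d)%N <> f x.
  move=> d0 dn' /(cyc_order_modn cf) /eqP.
  rewrite -[X in _ == X %[mod n]]addn0 eqn_modDl mod0n modn_small // => /eqP; lia.
have ab : (i * (k - l) < j * (k - l))%N by rewrite ltn_pmul2r ?subn_gt0.
have segP y : (exists2 t, (t < k)%N & y = f (i * (k - l) + t)%N) <->
              (exists2 t, (t < k)%N & y = f (j * (k - l) + t)%N).
  by split=> /in_lseg h; apply/in_lseg; [rewrite -seg | rewrite seg].
move: jn ab segP; set a := (i * _)%N; set b := (j * _)%N => jn ab segP.
case: (leqP (b - a) k) => abk.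
  have [|t' t'k] := (segP (f b.-1)).1; first by exists (b.-1 - a)%N; [lia | congr f; lia].
  move/esym; have -> : (b + t' = b.-1 + t'.+1)%N by lia.
  by apply: abs; lia.
have [|t tk] := (segP (f b)).2; first by exists 0%N; [lia | rewrite addn0].
have {1}-> : (b = (a + t) + (b - a - t))%N by lia.
by apply: abs; lia.
Qed.

Definition ham_edge_sets (n k l : nat) : {set {set {set 'I_n}}} :=
  [set M | `[< exists f : nat -> 'I_n, lcycle_shape n k l f /\
      M = [set lseg n k l f i | i : 'I_(nedges n k l)] >]].

Lemma ham_edge_setsP (n k l : nat) (M : {set {set 'I_n}}) :
  reflect (exists2 f : nat -> 'I_n, lcycle_shape n k l f &
      M = [set lseg n k l f i | i : 'I_(nedges n k l)]) (M \in ham_edge_sets n k l).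
Proof.
rewrite inE; apply: (iffP (asboolP _)) => [[f [fs ->]]|[f fs ->]]; first by exists f.
by exists f.
Qed.

Lemma card_ham_edge_set (n k l : nat) (M : {set {set 'I_n}}) :
  M \in ham_edge_sets n k l -> (#|M| <= nedges n k l)%N.
Proof.
move=> /ham_edge_setsP[f _ ->]; apply: leq_trans (leq_imset_card _ _) _.
by rewrite cardT size_enum_ord.
Qed.

Lemma has_ham_lcycleE (n k l : nat) (H : {set {set 'I_n}}) :
  `[< has_ham_lcycle n k l H >] = ~~ avoids (ham_edge_sets n k l) H.
Proof.
apply/asboolP/avoidsPn => [[f [fs fH]]|[M /ham_edge_setsP[f fs ->] MH]].
  exists [set lseg n k l f i | i : 'I_(nedges n k l)]; first by apply/ham_edge_setsP; exists f.
  by apply/subsetP => _ /imsetP[i _ ->]; apply: fH.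
exists f; split=> // i im; apply: (subsetP MH).
by apply/imsetP; exists (Ordinal im).
Qed.

Lemma rainbow_on_ham (n k l c : nat) (w : {ffun {set 'I_n} -> option 'I_c}) :
  (l < k)%N -> (k < n)%N -> (k - l %| n)%N ->
  (forall e, w e != None -> e \in ksets n k) ->
  rainbow_on (ham_edge_sets n k l) (ksets n k) w -> has_rainbow_ham_lcycle n k l c w.
Proof.
move=> lk kn dn wk /rainbow_onP[M /ham_edge_setsP[f fs ->] [Mw inj]].
have segM i : (i < nedges n k l)%N ->
    lseg n k l f i \in [set lseg n k l f i | i : 'I_(nedges n k l)].
  by move=> im; apply/imsetP; exists (Ordinal im).
exists f; split=> //; split=> [i im|i j im jm eqij]; first exact/Mw/segM.
have [cf _] := fs; apply: (lseg_inj lk kn dn cf im jm).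
by apply: inj (eqij); rewrite ?segM ?wk ?Mw ?segM.
Qed.

Lemma prob_binomE (R : realType) (n k l : nat) (u : R) :
  prob_binom n k u (has_ham_lcycle n k l) =
  \sum_(B | ~~ avoids (ham_edge_sets n k l) B) bern (fun e => if e \in ksets n k then u else 0) B.
Proof.
rewrite /prob_binom [RHS](bigID (fun B : {set {set 'I_n}} => B \subset ksets n k)) /=.
rewrite [X in _ = _ + X]big1 ?addr0; last first.
  by move=> B /andP[_ /negbTE BE]; rewrite bern_on BE.
apply: eq_big => [B|B /andP[BE _]]; first by rewrite has_ham_lcycleE andbC.
by rewrite bern_on BE.
Qed.

Lemma sum_bern_avoidsN (T : finType) (R : realType) (F : {set {set T}}) (E : {set T}) (u : R) :
  \sum_(B | ~~ avoids F B) bern (fun e => if e \in E then u else 0) B =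
  1 - (avoid_poly R F E).[u].
Proof.
rewrite horner_avoid_poly.
have := sum_bern (fun e => if e \in E then u else 0).
by rewrite (bigID (avoids F)) /= => <-; rewrite [X in X - _]addrC addrK.
Qed.

Lemma prob_col_ge (R : realType) (n k l c : nat) (q p : R) :
  (l < k)%N -> (k < n)%N -> (k - l %| n)%N -> 0 <= q <= 1 ->
  \sum_(w : {ffun {set 'I_n} -> option 'I_c}) prod_wt (hybrid_wt (ksets n k) p q (ksets n k)) w *
     (rainbow_on (ham_edge_sets n k l) (ksets n k) w)%:R
  <= prob_col n k c q (has_rainbow_ham_lcycle n k l c).
Proof.
move=> lk kn dn /andP[q0 q1]; rewrite /prob_col [leRHS]big_mkcond; apply: ler_sum => w _.
have [/forallP sw|/forallPn[e]] := boolP [forall e, (w e != None) ==> (e \in ksets n k)];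
  last first.
  rewrite negb_imply => /andP[we ek] /=.
  by rewrite /prod_wt (bigD1 e) //= /hybrid_wt (negbTE ek) (negbTE we) !mul0r.
have wk e : w e != None -> e \in ksets n k by apply/implyP.
have wtE : prod_wt (hybrid_wt (ksets n k) p q (ksets n k)) w =
    \prod_(e in ksets n k) (if w e is Some _ then q / c%:R else 1 - q).
  rewrite /prod_wt [RHS]big_mkcond; apply: eq_bigr => e _; rewrite /hybrid_wt.
  case: (boolP (e \in ksets n k)) => // ek.
  by case: eqP => // /eqP/wk; rewrite (negbTE ek).
have wt0 : 0 <= \prod_(e in ksets n k) (if w e is Some _ then q / c%:R else 1 - q).
  by apply: prodr_ge0 => i _; case: (w i) => [?|]; rewrite ?divr_ge0 ?subr_ge0.
rewrite wtE /=; have [r|_] := boolP (rainbow_on _ _ w); last first.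
  by rewrite mulr0; case: ifP.
have /asboolP-> := rainbow_on_ham lk kn dn wk r.
by rewrite mulr1.
Qed.

Lemma avoid_poly_gt0 (T : finType) (R : realType) (F : {set {set T}}) (E : {set T}) (u : R) :
  avoids F set0 -> 0 <= u < 1 -> 0 < (avoid_poly R F E).[u].
Proof.
move=> F0 /andP[u0 u1]; rewrite horner_avoid_poly (bigD1 set0) //=.
apply: ltr_wpDr.
  by apply: sumr_ge0 => B _; apply: bern_ge0 => e; case: ifP => _; rewrite ?lexx ?u0 ?ltW.
by rewrite bern_on sub0set cards0 subn0 mul1r exprn_gt0 // subr_gt0.
Qed.

Lemma avoid_poly0 (T : finType) (R : realType) (F : {set {set T}}) (E : {set T}) :
  avoids F set0 -> 1 <= (avoid_poly R F E).[0].
Proof.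
move=> F0; rewrite horner_avoid_poly (bigD1 set0) //= bern_on sub0set cards0 subn0 mul1r.
rewrite subr0 expr1n lerDl.
by apply: sumr_ge0 => B _; apply: bern_ge0 => e; rewrite if_same lexx ler01.
Qed.

Lemma avoid_poly_lt1 (T : finType) (R : realType) (F : {set {set T}}) (E : {set T}) (u v : R) :
  0 < v < 1 -> (avoid_poly R F E).[u] < 1 -> (avoid_poly R F E).[v] < 1.
Proof.
move=> /andP[v0 v1]; rewrite -subr_gt0 -sum_bern_avoidsN => gu.
rewrite -subr_gt0 -sum_bern_avoidsN; move: gu.
have v01 e : 0 <= (if e \in E then v else 0) <= 1 by case: ifP; rewrite ?lexx ?ler01 ?ltW.
have [avE|avE] := boolP (avoids F E).
  rewrite big1 ?ltxx // => B avB; rewrite bern_on; case: ifP => // BE.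
  by rewrite (avoidsS BE avE) in avB.
move=> _; rewrite (bigD1 E) //=; apply: ltr_wpDr.
  by apply: sumr_ge0 => B _; apply: bern_ge0.
by rewrite bern_on subxx mulr_gt0 ?exprn_gt0 ?subr_gt0.
Qed.

Lemma avoid_poly_transfer (T : finType) (R : realType) (F : {set {set T}}) (E : {set T})
    (s : nat) (a b eta : R) :
  (0 < s)%N -> (forall M, M \in F -> (#|M| <= s)%N) -> avoids F set0 ->
  0 < a -> a < b -> b < 1 -> 0 < eta -> (b - a) * (eta * s%:R) <= a ->
  (avoid_poly R F E).[b] < 1 ->
  - ln (avoid_poly R F E).[b] <= expR (4 / (eta * (1 - b))) * - ln (avoid_poly R F E).[a].
Proof.
move=> s0 Fs F0 a0 ab b1 eta0 step gb.
have sR : 0 < s%:R :> R by rewrite ltr0n.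
apply: neg_ln_transfer => // u /andP[au ub].
  rewrite avoid_poly_gt0 ?(avoid_poly_lt1 _ gb) ?(lt_le_trans a0 au) ?(le_lt_trans ub b1) //.
  by rewrite (le_trans (ltW a0) au).
have u0 : 0 < u by apply: lt_le_trans au.
have u1 : u < 1 by apply: le_lt_trans b1.
set g := (avoid_poly R F E).[u].
have g0 : 0 < g by rewrite avoid_poly_gt0 ?(ltW u0).
have g1 : g < 1 by rewrite (avoid_poly_lt1 _ gb) ?u0.
pose S := \sum_(B | avoids F B) bern (fun e => if e \in E then u else 0) B * #|pivots F E B|%:R : R.
have dS : (1 - u) * (avoid_poly R F E)^`().[u] = - S := avoid_poly_derivative F E u.
have x01 e : 0 <= (if e \in E then u else 0) <= 1 by case: ifP; rewrite ?lexx ?ler01 ?ltW.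
have SL : u / (4 * s%:R) * S <= g * - ln g.
  rewrite /g horner_avoid_poly; apply: sum_pivots_le => //; first exact: ltW.
    by move=> e ->.
  by rewrite -horner_avoid_poly.
have S0 : 0 <= S by apply: sumr_ge0 => B _; rewrite mulr_ge0 ?bern_ge0.
have L0 : 0 < g * - ln g by rewrite mulr_gt0 // oppr_gt0 ln_lt0 ?g0.
have b1' : 0 < 1 - b by rewrite subr_gt0.
have u1' : 0 < 1 - u by rewrite subr_gt0.
have -> : - (avoid_poly R F E)^`().[u] = S / (1 - u).
  by rewrite -[S]opprK -dS; field; rewrite gt_eqF.
have SL' : S * u <= 4 * s%:R * (g * - ln g).
  have -> : S * u = 4 * s%:R * (u / (4 * s%:R) * S) by field; rewrite gt_eqF.
  by apply: ler_wpM2l SL; rewrite mulr_ge0 ?ltW.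
have ba : b - a <= u / (eta * s%:R).
  by rewrite ler_pdivlMr ?mulr_gt0 //; apply: le_trans au.
apply: (@le_trans _ _ (S / (1 - u) * (u / (eta * s%:R)))).
  by apply: ler_wpM2l ba; rewrite divr_ge0 ?(ltW u1').
have -> : S / (1 - u) * (u / (eta * s%:R)) = S * u / ((1 - u) * (eta * s%:R)).
  by field; rewrite !gt_eqF.
apply: (@le_trans _ _ (4 * s%:R * (g * - ln g) / ((1 - u) * (eta * s%:R)))).
  by apply: ler_wpM2r SL'; rewrite invr_ge0 !mulr_ge0 ?(ltW u1') ?(ltW eta0).
have -> : 4 * s%:R * (g * - ln g) / ((1 - u) * (eta * s%:R)) =
          4 / (eta * (1 - u)) * (g * - ln g).
  by field; rewrite !gt_eqF.
apply: ler_wpM2r; first exact: ltW.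
apply: ler_wpM2l => //; rewrite lef_pV2 ?posrE ?mulr_gt0 //.
by apply: ler_wpM2l; [exact: ltW | lra].
Qed.

Unset Implicit Arguments.

(* c n is the number of colours: the integer part of (1+eps) m_l (see NOTES). *)
Theorem theorem3 (R : realType) (k l : nat) (p : nat -> R) :
  (l < k)%N ->
  (forall n, 0 <= p n <= 1) ->
  (forall delta : R, 0 < delta -> exists N : nat, forall n : nat,
      (N <= n)%N -> (k - l %| n)%N ->
      1 - delta <= prob_binom n k (p n) (has_ham_lcycle n k l)) ->
  forall (eps : R) (c : nat -> nat), 0 < eps ->
  (forall n, (c n)%:R <= (1 + eps) * (n%:R / (k - l)%:R) < (c n).+1%:R) ->
  let q := fun n : nat => (c n)%:R * p n / (eps * (n%:R / (k - l)%:R) + 1) in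
  forall delta : R, 0 < delta -> exists N : nat, forall n : nat,
      (N <= n)%N -> (k - l %| n)%N -> q n <= 1 ->
      1 - delta <= prob_col n k (c n) (q n) (has_rainbow_ham_lcycle n k l (c n)).
Proof.
move=> lk p01 ham eps c eps0 cn q delta delta0.
pose d1 := Num.min delta (1 / 2); pose D := 8 * (1 + eps) / eps.
have d1_gt0 : 0 < d1 by rewrite lt_min delta0; lra.
have d1_lt1 : d1 < 1 by rewrite gt_min; apply/orP; right; lra.
have lnd1 : ln d1 < 0 by rewrite ln_lt0 ?d1_gt0.
have [N0 HN0] := ham (expR (expR D * ln d1)) (expR_gt0 _).
exists (maxn N0 (maxn (4 * (k - l)) k.+1)) => n; rewrite !geq_max => /and3P[nN0 n4 kn] dn qn1.
have kl0 : (0 < k - l)%N by rewrite subn_gt0.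
set m := nedges n k l.
have mE : n%:R / (k - l)%:R = m%:R :> R.
  by rewrite -{1}(divnK dn) natrM mulfK // pnatr_eq0 -lt0n.
have m4 : (4 <= m)%N by rewrite leq_divRL.
have m4R : 4 <= m%:R :> R by rewrite (ler_nat R 4 m).
have := cn n; rewrite mE -addn1 natrD => /andP[cm1 cm2].
set C : R := (c n)%:R in cm1 cm2.
set P := p n; have /andP[P0 P1] : 0 <= P <= 1 := p01 n.
have em : 0 < eps * m%:R by rewrite mulr_gt0 //; lra.
have C3 : 3 < C by lra.
have c0 : (0 < c n)%N by rewrite -(ltr0n R) -/C; lra.
have qE : q n = C * P / (eps * m%:R + 1) by rewrite /q mE.
have P1' : 1 <= (1 - P) * (2 * (1 + eps)).
  have : C * P <= eps * m%:R + 1.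
    by move: qn1; rewrite qE ler_pdivrMr ?mul1r //; lra.
  move=> CP; have h : 1 * m%:R <= (1 - P) * (2 * (1 + eps)) * m%:R.
    have : ((1 + eps) * m%:R - 1) * P <= C * P by apply: ler_wpM2r => //; lra.
    nra.
  by rewrite ler_pM2r in h; lra.
have Plt1 : P < 1 by rewrite -subr_gt0; nra.
set F := ham_edge_sets n k l; set E := ksets n k.
set g := avoid_poly R F E.
have Fm M : M \in F -> (#|M| <= m)%N by apply: card_ham_edge_set.
have F0 : avoids F set0.
  apply/forall_inP => M /ham_edge_setsP[f _ ->]; apply/negP => /subsetP h.
  have m0 : (0 < nedges n k l)%N by apply: leq_trans m4.
  have /h : lseg n k l f 0 \in [set lseg n k l f i | i : 'I_(nedges n k l)].
    by apply/imsetP; exists (Ordinal m0).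
  by rewrite inE.
have gP : g.[P] <= expR (expR D * ln d1).
  by have := HN0 n nN0 dn; rewrite prob_binomE sum_bern_avoidsN -/P -/g; lra.
have gP1 : g.[P] < 1.
  apply: le_lt_trans gP _; rewrite -expR0 ltr_expR.
  by rewrite pmulr_rlt0 ?expR_gt0.
have P_gt0 : 0 < P.
  rewrite lt_neqAle P0 andbT; apply: contraTneq gP1 => <-.
  by rewrite -leNgt avoid_poly0.
pose P' := P * (eps * m%:R) / (eps * m%:R + 1).
have em1 : 0 < eps * m%:R + 1 by lra.
have P'_gt0 : 0 < P' by rewrite /P' divr_gt0 // mulr_gt0.
have P'P : P - P' = P / (eps * m%:R + 1) by rewrite /P'; field; rewrite gt_eqF.
have P'lt : P' < P by rewrite -subr_gt0 P'P divr_gt0.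
have transfer : - ln g.[P] <= expR (4 / (eps * (1 - P))) * - ln g.[P'].
  apply: (@avoid_poly_transfer _ _ F E m) => //; first by apply: leq_trans m4.
  by rewrite P'P /P' mulrAC.
have g'0 : 0 < g.[P'] by rewrite avoid_poly_gt0 ?(ltW P'_gt0) ?(lt_trans P'lt).
have g'1 : g.[P'] < 1 by rewrite (avoid_poly_lt1 _ gP1) // P'_gt0 (lt_trans P'lt).
have g'd : g.[P'] <= d1.
  have g0 : 0 < g.[P] by rewrite avoid_poly_gt0 ?P0.
  rewrite -ler_ln ?posrE // -lerN2 -(ler_pM2l (expR_gt0 D)).
  apply: (@le_trans _ _ (- ln g.[P])).
    by rewrite mulrN lerN2 -ler_expR lnK ?posrE.
  apply: le_trans transfer _; apply: ler_wpM2r.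
    by rewrite oppr_ge0 ltW // ln_lt0 ?g'0.
  rewrite ler_expR /D ler_pdivrMr ?mulr_gt0 ?subr_gt0 //.
  have -> : 8 * (1 + eps) / eps * (eps * (1 - P)) = 4 * ((1 - P) * (2 * (1 + eps))).
    by field; rewrite gt_eqF.
  lra.
have q01 : 0 <= q n <= 1 by rewrite qn1 andbT qE divr_ge0 ?mulr_ge0 ?(ltW em1) //; lra.
apply: le_trans (@prob_col_ge R n k l (c n) (q n) P' lk kn dn q01).
apply: (@le_trans _ _ (1 - g.[P'])).
  have : d1 <= delta by rewrite ge_min lexx.
  lra.
rewrite -sum_bern_avoidsN -(sum_rainbow_on0 F E P' (q n) c0).
apply: (@rainbow_on_le _ _ _ m) => //; first by rewrite (ltW P'_gt0) (ltW (lt_trans P'lt _)).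
rewrite -/C qE /P'.
have -> : C * P / (eps * m%:R + 1) / C * (C - m%:R + 1) = P * (C - m%:R + 1) / (eps * m%:R + 1).
  by field; rewrite !gt_eqF //; lra.
apply: ler_wpM2r; first by rewrite invr_ge0 ltW.
by apply: ler_wpM2l => //; lra.
Qed.
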